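(* Let $\mathbb{K}$ be a field and let $\underline{\mathcal{A}}=(A_1,\ldots,A_n)$ be any ordered $n$-tuple of $n\times n$ matrices with entries in $\mathbb{K}$. Let $\tau_{\underline{i}}(\underline{\mathcal{A}})\in\mathbb{K}$, $\underline{i}\in\mathbb{N}^n$, denote the $\underline{i}$-trace of the $n$-tuple of matrices thought of as endomorphisms of $\mathbb{K}^n$. Then the following identity of $n\times n$ matrices holds: $$ \sum_{k=0}^n(-1)^k\frac{1}{k!}\sum_{\sigma\in S_n}\tau_{\mathbf{e}_{\sigma(1)}+\cdots+\mathbf{e}_{\sigma(k)}}(\underline{\mathcal{A}})\cdot \bigl(A_{\sigma(k+1)}\cdots A_{\sigma(n)}\bigr)=0, $$ where $(\mathbf{e}_1,\ldots,\mathbf{e}_n)$ is the canonical basis of $\mathbb{Z}^n$ and $S_n$ is the symmetric group on $n$ letters.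
   Context: Notation: let $V=\mathbb{K}^n$ and let $\bigwedge V=\bigoplus_{j\ge 0}\bigwedge^jV$ be its exterior algebra; $\underline{z}=(z_1,\ldots,z_n)$ are $n$ formal variables; for $\underline{i}=(i_1,\ldots,i_n)\in\mathbb{N}^n$ (with $0\in\mathbb{N}$) put $\underline{z}^{\underline{i}}=z_1^{i_1}\cdots z_n^{i_n}$ and $|\underline{i}|=i_1+\cdots+i_n$; $\bigwedge V[[\underline{z}]]$ is the algebra of formal power series in $\underline{z}$ with coefficients in $\bigwedge V$. Multivariate HS-derivation: an ($n$-)multivariate Hasse–Schmidt derivation on $\bigwedge V$ is a $\mathbb{K}$-algebra homomorphism $\mathcal{D}(\underline{z}):\bigwedge V\to\bigwedge V[[\underline{z}]]$, i.e. a $\mathbb{K}$-linear map with $\mathcal{D}(\underline{z})(1)=1$ and $\mathcal{D}(\underline{z})(u\wedge v)=\mathcal{D}(\underline{z})u\wedge\mathcal{D}(\underline{z})v$ for all $u,v\in\bigwedge V$. Given $\underline{\mathcal{A}}=(A_1,\ldots,A_n)$, let $\overline{\mathcal{D}}(\underline{z})$ be the unique multivariate HS-derivation on $\bigwedge V$ whose restriction to $V=\bigwedge^1V$ is $\mathrm{id}_V-(A_1z_1+\cdots+A_nz_n)$, and write $\overline{\mathcal{D}}(\underline{z})=\sum_{\underline{i}\in\mathbb{N}^n}(-1)^{|\underline{i}|}\overline{D}_{\underline{i}}\,\underline{z}^{\underline{i}}$ with $\overline{D}_{\underline{i}}\in\mathrm{End}_{\mathbb{K}}(\bigwedge V)$.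 Each $\overline{D}_{\underline{i}}$ maps the one-dimensional space $\bigwedge^nV$ to itself. The $\underline{i}$-trace $\tau_{\underline{i}}(\underline{\mathcal{A}})\in\mathbb{K}$ is the scalar defined by $\tau_{\underline{i}}(\underline{\mathcal{A}})\,\xi=\overline{D}_{\underline{i}}\xi$ for any nonzero $\xi\in\bigwedge^nV$. Conventions: the summand for $k=0$ is $\sum_{\sigma\in S_n}A_{\sigma(1)}\cdots A_{\sigma(n)}$ (since $\tau_{\underline{0}}(\underline{\mathcal{A}})=1$); for $k=n$ the empty product is the identity matrix, so that the summand is $(-1)^n\tau_{(1,\ldots,1)}(\underline{\mathcal{A}})$ times the identity matrix. For each $k$, the term indexed by $\sigma$ depends only on $\sigma(k+1),\ldots,\sigma(n)$, so each term is repeated $k!$ times; the factor $\frac{1}{k!}$ removes this repetition. If $k!$ is not invertible in $\mathbb{K}$, the expression $\frac{1}{k!}\sum_{\sigma\in S_n}$ is to be read as the sum over those $\sigma\in S_n$ with $\sigma(1)<\cdots<\sigma(k)$. *)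

(* Defs.v *)
From HB Require Import structures.
From mathcomp Require Import all_boot all_order all_fingroup all_algebra.
From mathcomp Require Export mpoly.

Set Implicit Arguments.
Unset Strict Implicit.
Unset Printing Implicit Defensive.

Import GRing.Theory.
Local Open Scope ring_scope.

(* The exterior algebra of K^n, in its standard basis: the coefficient of     *)
(* u at S = {s_1 < ... < s_j} is that of e_S = e_{s_1} /\ ... /\ e_{s_j}.     *)
Definition exterior (K : fieldType) (n : nat) : Type :=
  {ffun {set 'I_n} -> K^o}.

HB.instance Definition _ (K : fieldType) (n : nat) :=
  GRing.Lmodule.copy (exterior K n) {ffun {set 'I_n} -> K^o}.

Definition ebasis (K : fieldType) (n : nat) (S : {set 'I_n}) : exterior K n :=
  [ffun T => (T == S)%:R].

(* Number of pairs (s, t) in S x T with t < s: its parity is the sign of the  *)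
(* permutation which sorts the concatenation of S and T.                      *)
Definition inversions (n : nat) (S T : {set 'I_n}) : nat :=
  (\sum_(s in S) \sum_(t in T) (t < s))%N.

Definition ebasis_mul (K : fieldType) (n : nat) (S T : {set 'I_n}) :
    exterior K n :=
  if [disjoint S & T] then (-1) ^+ inversions S T *: ebasis K (S :|: T) else 0.

Definition wedge (K : fieldType) (n : nat) (u v : exterior K n) :
    exterior K n :=
  \sum_S \sum_T (u S * v T) *: ebasis_mul K S T.

Section ExteriorRing.
Variables (K : fieldType) (n : nat).
Implicit Types (S T U : {set 'I_n}) (u v w : exterior K n).

Fact exteriorE u : u = \sum_S u S *: ebasis K S.
Proof.
apply/ffunP => T; rewrite sum_ffunE (bigD1 T) //= !ffunE eqxx.
rewrite big1 => [|S neST]; first by rewrite addr0 /GRing.scale /= mulr1.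
by rewrite !ffunE eq_sym (negPf neST) scaler0.
Qed.

Fact wedgeDl u v w : wedge (u + v) w = wedge u w + wedge v w.
Proof.
rewrite /wedge -big_split; apply: eq_bigr => S _ /=.
rewrite -big_split; apply: eq_bigr => T _ /=.
by rewrite ffunE mulrDl scalerDl.
Qed.

Fact wedgeDr u v w : wedge u (v + w) = wedge u v + wedge u w.
Proof.
rewrite /wedge -big_split; apply: eq_bigr => S _ /=.
rewrite -big_split; apply: eq_bigr => T _ /=.
by rewrite ffunE mulrDr scalerDl.
Qed.

Fact wedgeZl a u v : wedge (a *: u) v = a *: wedge u v.
Proof.
rewrite /wedge scaler_sumr; apply: eq_bigr => S _.
rewrite scaler_sumr; apply: eq_bigr => T _.
by rewrite ffunE scalerA mulrA.
Qed.

Fact wedgeZr a u v : wedge u (a *: v) = a *: wedge u v.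
Proof.
rewrite /wedge scaler_sumr; apply: eq_bigr => S _.
rewrite scaler_sumr; apply: eq_bigr => T _.
by rewrite ffunE scalerA mulrCA.
Qed.

Fact wedge0l u : wedge 0 u = 0.
Proof. by rewrite -(scale0r (0 : exterior K n)) wedgeZl !scale0r. Qed.

Fact wedge0r u : wedge u 0 = 0.
Proof. by rewrite -(scale0r (0 : exterior K n)) wedgeZr !scale0r. Qed.

Fact wedge_suml (I : finType) (F : I -> exterior K n) u :
  wedge (\sum_i F i) u = \sum_i wedge (F i) u.
Proof.
by elim/big_rec2: _ => [|i x y _ <-]; rewrite ?wedge0l // wedgeDl.
Qed.

Fact wedge_sumr (I : finType) (F : I -> exterior K n) u :
  wedge u (\sum_i F i) = \sum_i wedge u (F i).
Proof.
by elim/big_rec2: _ => [|i x y _ <-]; rewrite ?wedge0r // wedgeDr.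
Qed.

Fact wedge_ebasis S T : wedge (ebasis K S) (ebasis K T) = ebasis_mul K S T.
Proof.
rewrite /wedge (bigD1 S) //= (bigD1 T) //= !ffunE !eqxx mulr1 scale1r.
rewrite big1 => [|U neUT]; last by rewrite !ffunE (negPf neUT) mulr0 scale0r.
rewrite addr0 big1 => [|U neUS]; first by rewrite addr0.
by apply: big1 => W _; rewrite !ffunE (negPf neUS) mul0r scale0r.
Qed.

Fact inversionsUl S T U : [disjoint S & T] ->
  inversions (S :|: T) U = (inversions S U + inversions T U)%N.
Proof.
move=> dST; rewrite /inversions -bigU //=.
by apply: eq_bigl => s; rewrite !inE.
Qed.

Fact inversionsUr S T U : [disjoint T & U] ->
  inversions S (T :|: U) = (inversions S T + inversions S U)%N.
Proof.
move=> dTU; rewrite /inversions -big_split; apply: eq_bigr => s _ /=.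
by rewrite -bigU //=; apply: eq_bigl => t; rewrite !inE.
Qed.

Definition esign S T : int :=
  if [disjoint S & T] then (-1) ^+ inversions S T else 0.

Fact ebasis_mulE S T : ebasis_mul K S T = ebasis K (S :|: T) *~ esign S T.
Proof.
rewrite /ebasis_mul /esign; case: ifP => // _.
by rewrite -scaler_int rmorph_sign.
Qed.

Fact esign_cocycle S T U :
  esign S T * esign (S :|: T) U = esign T U * esign S (T :|: U).
Proof.
rewrite /esign -![[disjoint _ :|: _ & _]]setI_eq0 setIUl setU_eq0 !setI_eq0.
rewrite -![[disjoint _ & _ :|: _]]setI_eq0 setIUr setU_eq0 !setI_eq0.
case dST: [disjoint S & T]; case dTU: [disjoint T & U];
  rewrite ?andbF ?mul0r ?mulr0 //=.
case: [disjoint S & U]; rewrite ?mulr0 //.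
by rewrite -!exprD inversionsUl // inversionsUr // addnA [in RHS]addnC.
Qed.

Fact wedgeZz u v z : wedge (u *~ z) v = wedge u v *~ z.
Proof. by rewrite -scaler_int wedgeZl scaler_int. Qed.

Fact wedgezZ u v z : wedge u (v *~ z) = wedge u v *~ z.
Proof. by rewrite -scaler_int wedgeZr scaler_int. Qed.

Fact wedge_ebasisA S T U :
  wedge (ebasis K S) (wedge (ebasis K T) (ebasis K U)) =
  wedge (wedge (ebasis K S) (ebasis K T)) (ebasis K U).
Proof.
rewrite !wedge_ebasis !ebasis_mulE wedgeZz wedgezZ !wedge_ebasis !ebasis_mulE.
by rewrite setUA -!mulrzA mulrC -esign_cocycle mulrC.
Qed.

Fact wedgeA : associative (@wedge K n).
Proof.
move=> u v w; rewrite (exteriorE u) [LHS]wedge_suml.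
rewrite [X in _ = wedge X w]wedge_suml [RHS]wedge_suml; apply: eq_bigr => S _.
rewrite !wedgeZl; congr (_ *: _).
rewrite (exteriorE v) [X in wedge _ X = _]wedge_suml [LHS]wedge_sumr.
rewrite [X in _ = wedge X w]wedge_sumr [RHS]wedge_suml; apply: eq_bigr => T _.
rewrite !(wedgeZl, wedgeZr); congr (_ *: _).
rewrite (exteriorE w) [X in wedge _ X = _]wedge_sumr [LHS]wedge_sumr.
rewrite [RHS]wedge_sumr; apply: eq_bigr => U _.
by rewrite !(wedgeZl, wedgeZr) wedge_ebasisA.
Qed.

Fact esign0l S : esign set0 S = 1.
Proof. by rewrite /esign -setI_eq0 set0I eqxx /inversions big_set0. Qed.

Fact esign0r S : esign S set0 = 1.
Proof.
rewrite /esign -setI_eq0 setI0 eqxx /inversions.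
by rewrite big1 // => s _; rewrite big_set0.
Qed.

Fact wedge1u : left_id (ebasis K set0) (@wedge K n).
Proof.
move=> u; rewrite [in RHS](exteriorE u) {1}(exteriorE u) wedge_sumr.
apply: eq_bigr => S _.
by rewrite wedgeZr wedge_ebasis ebasis_mulE esign0l set0U.
Qed.

Fact wedgeu1 : right_id (ebasis K set0) (@wedge K n).
Proof.
move=> u; rewrite [in RHS](exteriorE u) {1}(exteriorE u) wedge_suml.
apply: eq_bigr => S _.
by rewrite wedgeZl wedge_ebasis ebasis_mulE esign0r setU0.
Qed.

Fact ebasis0_neq0 : ebasis K set0 != 0 :> exterior K n.
Proof.
by apply/eqP => /ffunP/(_ set0)/eqP; rewrite !ffunE eqxx oner_eq0.
Qed.

End ExteriorRing.

HB.instance Definition _ (K : fieldType) (n : nat) :=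
  GRing.Zmodule_isNzRing.Build (exterior K n) (@wedgeA K n) (@wedge1u K n)
    (@wedgeu1 K n) (@wedgeDl K n) (@wedgeDr K n) (@ebasis0_neq0 K n).

HB.instance Definition _ (K : fieldType) (n : nat) :=
  GRing.Lmodule_isLalgebra.Build K (exterior K n)
    (fun a u v => esym (wedgeZl a u v)).

HB.instance Definition _ (K : fieldType) (n : nat) :=
  GRing.Lalgebra_isAlgebra.Build K (exterior K n)
    (fun a u v => esym (wedgeZr a u v)).

(* The identification of K^n with the degree 1 part. *)
Definition evec (K : fieldType) (n : nat) (v : 'cV[K]_n) : exterior K n :=
  \sum_i v i 0 *: ebasis K [set i].

Definition ext_homog (K : fieldType) (n j : nat) (u : exterior K n) : Prop :=
  forall S, u S != 0 -> #|S| = j.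

(* Formal power series in n commuting variables over the exterior algebra,    *)
(* as families of coefficients.                                               *)
Definition eseries (K : fieldType) (n : nat) : Type :=
  'X_{1..n} -> exterior K n.

Definition eseries_one (K : fieldType) (n : nat) : eseries K n :=
  fun m => if m == 0%MM then 1 else 0.

(* The degree bounds only make the index set finite: they follow from         *)
(* m = k.1 + k.2.                                                             *)
Definition eseries_mul (K : fieldType) (n : nat) (p q : eseries K n) :
    eseries K n :=
  fun m => \sum_(k : 'X_{1..n < (mdeg m).+1, (mdeg m).+1}
                  | m == (k.1 + k.2)%MM) p k.1 * q k.2.

Record HS_derivation (K : fieldType) (n : nat)
    (D : exterior K n -> eseries K n) : Prop := {
  HS_linear : forall m a u v, D (a *: u + v) m = a *: D u m + D v m;
  HS_one : D 1 =1 @eseries_one K n;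
  HS_mul : forall u v, D (u * v) =1 eseries_mul (D u) (D v)
}.

(* v |-> v - (A_1 v z_1 + ... + A_n v z_n) *)
Definition id_sub_sum (K : fieldType) (n : nat) (A : 'I_n -> 'M[K]_n)
    (v : 'cV[K]_n) : eseries K n :=
  fun m => (m == 0%MM)%:R *: evec v
           - \sum_j (m == U_(j)%MM)%:R *: evec (A j *m v).

(* The endomorphisms D_m such that D(z) = \sum_m (-1)^|m| D_m z^m. *)
Definition signed_coef (K : fieldType) (n : nat)
    (D : exterior K n -> eseries K n) (m : 'X_{1..n}) (u : exterior K n) :
    exterior K n :=
  (-1) ^+ mdeg m *: D u m.

(* 1/k! times the sum of F over the symmetric group, for an F which does not  *)
(* depend on the order of the first k values of the permutation; when k! is   *)
(* not invertible, one representative is taken for each of these orders.      *)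
Definition sum_perm_div_fact (K : fieldType) (n k : nat)
    (F : 'S_n -> 'M[K]_n) : 'M[K]_n :=
  if (k`!%:R : K) != 0 then (k`!%:R)^-1 *: \sum_(s : 'S_n) F s
  else \sum_(s : 'S_n | [forall i : 'I_n, forall j : 'I_n,
                           (i < j < k)%N ==> (s i < s j)%N]) F s.

(* The remaining facts show that, for given matrices, there is exactly one    *)
(* derivation D extending id_sub_sum, and that it has exactly one family tau  *)
(* of traces: see multitrace_exists and multitrace_unique.                    *)

Fact mul_exteriorE (K : fieldType) (n : nat) (u v : exterior K n) :
  u * v = wedge u v.
Proof. by []. Qed.

Fact one_exteriorE (K : fieldType) (n : nat) : 1 = ebasis K set0 :> exterior K n.
Proof. by []. Qed.

Section MinInduction.
Variable n : nat.
Implicit Types S T : {set 'I_n}.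

Fact set_min_ind (P : {set 'I_n} -> Prop) :
  P set0 ->
  (forall (m : 'I_n) S, (forall s, s \in S -> m < s)%N -> P S -> P (m |: S)) ->
  forall S, P S.
Proof.
move=> P0 PU S; have [k leSk] := ubnP #|S|.
elim: k => // k IHk in S leSk *.
have [->//|/set0Pn[x xS]] := eqVneq S set0.
case: (@arg_minnP _ x (mem S) val xS) => m mS minm.
rewrite -(setD1K mS); apply: PU => [s|].
  rewrite !inE => /andP[nesm sS]; rewrite ltn_neqAle minm // andbT.
  by rewrite eq_sym -(inj_eq val_inj) in nesm *.
by apply: IHk; move: leSk; rewrite (cardsD1 m S) [m \in S]mS.
Qed.

Fact esign_min (m : 'I_n) S T : (forall s, s \in S -> m < s)%N ->
  esign (m |: S) T = esign S T * esign [set m] (S :|: T).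
Proof.
move=> ltmS; rewrite -esign_cocycle [X in X * _](_ : _ = 1) ?mul1r //.
rewrite /esign disjoints1 (contra (ltmS m)) ?ltnn // /inversions big_set1.
by rewrite big1 // => s /ltmS; case: ltngtP.
Qed.

Section OrderedProduct.
Variables (R : nzRingType) (f : 'I_n -> R).

Definition eprod S := \prod_(s <- enum S) f s.

Fact eprod0 : eprod set0 = 1.
Proof. by rewrite /eprod enum_set0 big_nil. Qed.

Fact eprod_min (m : 'I_n) S : (forall s, s \in S -> m < s)%N ->
  eprod (m |: S) = f m * eprod S.
Proof.
move=> ltmS; have mNS : m \notin S by apply: contra (ltmS m) _; rewrite ltnn.
rewrite /eprod.
suff -> : enum (m |: S) = m :: enum S by rewrite big_cons.
pose lt := relpre (val : 'I_n -> nat) ltn.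
have lt_tr : transitive lt by move=> i j k; apply: ltn_trans.
have srt (T : {set 'I_n}) : sorted lt (enum T).
  rewrite /enum_mem sorted_filter // -enumT -sorted_map val_enum_ord.
  exact: iota_ltn_sorted.
apply: (irr_sorted_eq lt_tr) => [i||| i]; rewrite ?srt //.
- by rewrite /lt /= ltnn.
- rewrite /= path_min_sorted ?srt //; apply/allP => s.
  by rewrite mem_enum; apply: ltmS.
by rewrite !(inE, mem_enum).
Qed.

Fact eprod1 m : eprod [set m] = f m.
Proof. by rewrite /eprod enum_set1 big_seq1. Qed.

Hypothesis ff0 : forall i, f i * f i = 0.
Hypothesis ffN : forall i j, f i * f j = - (f j * f i).

Fact mul_eprod1 m S :
  f m * eprod S = eprod (m |: S) *~ esign [set m] S.
Proof.
elim/set_min_ind: S => [|i S ltiS IHS].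
  by rewrite setU0 eprod0 eprod1 esign0r mulr1.
rewrite eprod_min // mulrA.
have iNS : i \notin S by apply/negP => /ltiS; rewrite ltnn.
have inv1 : inversions [set m] (i |: S) = ((i < m) + inversions [set m] S)%N.
  by rewrite inversionsUr ?disjoints1 // /inversions !big_set1.
have [ltmi|ltim|/val_inj eqmi] := ltngtP m i.
- have ltmiS s : s \in i |: S -> (m < s)%N.
    by rewrite !inE => /predU1P[-> //|/ltiS]; apply: ltn_trans.
  rewrite -mulrA -eprod_min // -eprod_min //.
  rewrite /esign disjoints1 ifT ?inv1; last by apply/negP => /ltmiS; rewrite ltnn.
  rewrite ltnNge ltnW //= /inversions big_set1 big1 // => s /ltiS ltis.
  by rewrite ltnNge ltnW // (ltn_trans ltmi).
- rewrite ffN mulNr -mulrA IHS mulrzAr.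
  rewrite setUCA [in RHS]eprod_min; last first.
    by move=> s; rewrite !inE => /predU1P[-> //|/ltiS].
  rewrite -[LHS]mulrNz /esign inv1 ltim exprD !disjoints1 !inE.
  have -> /= : (m == i) = false by apply/eqP => eqmi; rewrite eqmi ltnn in ltim.
  by case: ifP; rewrite ?oppr0 // mulN1r.
by rewrite eqmi ff0 mul0r /esign disjoints1 setU11.
Qed.

Fact mul_eprod S T :
  eprod S * eprod T = eprod (S :|: T) *~ esign S T.
Proof.
elim/set_min_ind: S => [|m S ltmS IHS].
  by rewrite set0U eprod0 mul1r esign0l.
rewrite eprod_min // -mulrA IHS mulrzAr mul_eprod1 -mulrzA setUA.
by rewrite esign_min // mulrC.
Qed.
End OrderedProduct.
End MinInduction.

Fact sqr0_sum (R : nzRingType) (G : R -> Prop) (I : eqType) (r : seq I)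
    (F : I -> R) :
  (forall x, G x -> x * x = 0) -> (forall x y, G x -> G y -> x * y = - (y * x)) ->
  (forall i, i \in r -> G (F i)) ->
  (\sum_(i <- r) F i) * (\sum_(i <- r) F i) = 0.
Proof.
move=> G0 GN; elim: r => [|i r IHr] GF; first by rewrite big_nil mul0r.
have Gi : G (F i) by apply: GF; rewrite inE eqxx.
have Gr j : j \in r -> G (F j) by move=> jr; apply: GF; rewrite inE jr orbT.
rewrite big_cons mulrDl !mulrDr G0 // IHr // add0r addr0.
rewrite mulr_sumr mulr_suml -big_split big_seq big1 // => j jr.
by rewrite /= (GN _ (F j)) ?addNr //; apply: Gr.
Qed.

Fact anticomm_sum (R : nzRingType) (G : R -> Prop) (I J : eqType) (r : seq I)
    (s : seq J) (E : I -> R) (F : J -> R) :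
  (forall x y, G x -> G y -> x * y = - (y * x)) ->
  (forall i, i \in r -> G (E i)) -> (forall j, j \in s -> G (F j)) ->
  (\sum_(i <- r) E i) * (\sum_(j <- s) F j) =
  - ((\sum_(j <- s) F j) * (\sum_(i <- r) E i)).
Proof.
move=> GN GE GF; rewrite mulr_suml mulr_sumr -sumrN big_seq [RHS]big_seq.
apply: eq_bigr => i ir; rewrite mulr_sumr mulr_suml -sumrN big_seq [RHS]big_seq.
by apply: eq_bigr => j js; apply: GN; [apply: GE|apply: GF].
Qed.

Section LinearFamily.
Variables (K : fieldType) (n : nat) (D : exterior K n -> eseries K n).
Hypothesis Dlin : forall m a u v, D (a *: u + v) m = a *: D u m + D v m.

Fact Dlin0 m : D 0 m = 0.
Proof.
by have := Dlin m (-1) 0 0; rewrite scaler0 addr0 scaleN1r addNr.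
Qed.

Fact DlinZ m a u : D (a *: u) m = a *: D u m.
Proof. by rewrite -[a *: u]addr0 Dlin Dlin0 addr0. Qed.

Fact DlinD m u v : D (u + v) m = D u m + D v m.
Proof. by rewrite -[u]scale1r Dlin !scale1r. Qed.

Fact Dlin_sum (I : Type) (r : seq I) (E : I -> exterior K n) m :
  D (\sum_(i <- r) E i) m = \sum_(i <- r) D (E i) m.
Proof. by elim/big_rec2: _ => [|i y x _ <-]; rewrite ?Dlin0 // DlinD. Qed.

Fact DlinE m u : D u m = \sum_S u S *: D (ebasis K S) m.
Proof.
by rewrite {1}(exteriorE u) Dlin_sum; apply: eq_bigr => S _; rewrite DlinZ.
Qed.
End LinearFamily.

Section Existence.
Variables (K : fieldType) (n : nat).
Implicit Types (S T : {set 'I_n}) (u v : exterior K n) (x y : 'cV[K]_n).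

Fact ebasisM S T : ebasis K S * ebasis K T = ebasis K (S :|: T) *~ esign S T.
Proof. by rewrite -ebasis_mulE -wedge_ebasis. Qed.

Fact evecD x y : evec (x + y) = evec x + evec y.
Proof.
by rewrite -big_split; apply: eq_bigr => i _; rewrite /= mxE scalerDl.
Qed.

Fact evecZ a x : evec (a *: x) = a *: evec x.
Proof. by rewrite scaler_sumr; apply: eq_bigr => i _; rewrite mxE scalerA. Qed.

Fact evecN x : evec (- x) = - evec x.
Proof. by rewrite -scaleN1r evecZ scaleN1r. Qed.

Fact evec_delta (i : 'I_n) : evec (delta_mx i 0) = ebasis K [set i].
Proof.
rewrite /evec (bigD1 i) //= mxE !eqxx scale1r big1 ?addr0 // => j neji.
by rewrite mxE (negPf neji) scale0r.
Qed.

Let gen u := exists (a : K) (i : 'I_n), u = a *: ebasis K [set i].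

Fact gen_sqr0 u : gen u -> u * u = 0.
Proof.
case=> a [i ->]; rewrite -scalerAl -scalerAr ebasisM /esign disjoints1.
by rewrite inE eqxx !scaler0.
Qed.

Fact gen_anticomm u v : gen u -> gen v -> u * v = - (v * u).
Proof.
case=> a [i ->] [b [j ->]]; rewrite -!scalerAl -!scalerAr !ebasisM.
rewrite !scalerA (mulrC b) -scalerN setUC -mulrNz; congr (_ *: (_ *~ _)).
rewrite /esign !disjoints1 !inE (eq_sym j) /inversions !big_set1.
by have [->|] := eqVneq i j; case: ltngtP => // /val_inj ->; rewrite ?eqxx.
Qed.

Fact evec_sqr0 x : evec x * evec x = 0.
Proof.
by apply: (sqr0_sum gen_sqr0 gen_anticomm) => i _; exists (x i 0), i.
Qed.

Fact evec_anticomm x y : evec x * evec y = - (evec y * evec x).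
Proof.
by apply: (anticomm_sum gen_anticomm) => i _; [exists (x i 0), i | exists (y i 0), i].
Qed.

Let pgen (p : {mpoly (exterior K n)[n]}) :=
  exists x m, p = (evec x)%:MP * 'X_[m].

Fact pgenM x y (m k : 'X_{1..n}) :
  ((evec x)%:MP * 'X_[m]) * ((evec y)%:MP * 'X_[k]) =
  (evec x * evec y)%:MP * 'X_[m + k] :> {mpoly (exterior K n)[n]}.
Proof.
by rewrite mulrA -(mulrA _ 'X_[m]) -(commr_mpolyX m) mulrA -mulrA -mpolyXD mpolyCM.
Qed.

Fact pgen_sqr0 p : pgen p -> p * p = 0.
Proof. by case=> x [m ->]; rewrite pgenM evec_sqr0 mpolyC0 mul0r. Qed.

Fact pgen_anticomm p q : pgen p -> pgen q -> p * q = - (q * p).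
Proof.
case=> x [m ->] [y [k ->]].
by rewrite !pgenM evec_anticomm addmC mpolyCN mulNr.
Qed.

Variable A : 'I_n -> 'M[K]_n.

Let gens x : seq ('cV[K]_n * 'X_{1..n}) :=
  (x, 0%MM) :: [seq (- (A j *m x), U_(j)%MM) | j <- enum 'I_n].

Let F x : {mpoly (exterior K n)[n]} :=
  \sum_(p <- gens x) (evec p.1)%:MP * 'X_[p.2].

Let f i := F (delta_mx i 0).

Let ff0 i : f i * f i = 0.
Proof.
by apply: (sqr0_sum pgen_sqr0 pgen_anticomm) => -[y m] _; exists y, m.
Qed.

Let ffN i j : f i * f j = - (f j * f i).
Proof.
by apply: (anticomm_sum pgen_anticomm) => -[y m] _; exists y, m.
Qed.

Let coefF x m : (F x)@_m = id_sub_sum A x m.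
Proof.
rewrite /F big_cons big_map big_enum mcoeffD mcoeffCM mcoeffX eq_sym.
rewrite /id_sub_sum; congr (_ + _).
  by case: (_ == _); rewrite ?mulr1 ?mulr0 ?scale1r ?scale0r.
rewrite [LHS](raddf_sum (mcoeff m)) -sumrN; apply: eq_bigr => j _.
rewrite [LHS]mcoeffCM mcoeffX eq_sym evecN mulNr; congr (- _).
by case: (_ == _); rewrite ?mulr1 ?mulr0 ?scale1r ?scale0r.
Qed.

Definition HS_extension u : eseries K n :=
  fun m => \sum_S u S *: (eprod f S)@_m.

Fact HS_extension_linear m a u v :
  HS_extension (a *: u + v) m = a *: HS_extension u m + HS_extension v m.
Proof.
rewrite /HS_extension scaler_sumr -big_split; apply: eq_bigr => S _ /=.
by rewrite !ffunE scalerDl scalerA.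
Qed.

Fact HS_extension_ebasis S m : HS_extension (ebasis K S) m = (eprod f S)@_m.
Proof.
rewrite /HS_extension (bigD1 S) //= ffunE eqxx scale1r big1 ?addr0 // => T neTS.
by rewrite ffunE (negPf neTS) scale0r.
Qed.

Fact HS_extension_HS : HS_derivation HS_extension.
Proof.
have Dlin := HS_extension_linear.
split=> // [m|u v m].
  rewrite [LHS]HS_extension_ebasis eprod0 -mpolyC1 mcoeffC /eseries_one eq_sym.
  by case: (_ == _); rewrite ?mulr1 ?mulr0.
rewrite {1}(exteriorE u) mulr_suml (Dlin_sum Dlin).
have mulE S : HS_extension (ebasis K S * v) m =
    eseries_mul (fun k => (eprod f S)@_k) (HS_extension v) m.
  rewrite {1}(exteriorE v) mulr_sumr (Dlin_sum Dlin) /eseries_mul.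
  under [RHS]eq_bigr do rewrite mulr_sumr.
  rewrite [RHS]exchange_big; apply: eq_bigr => T _ /=.
  rewrite -scalerAr (DlinZ Dlin) ebasisM -scaler_int (DlinZ Dlin) scaler_int.
  rewrite HS_extension_ebasis -(raddfMz (mcoeff m)) -(mul_eprod ff0 ffN).
  rewrite [X in _ *: X]mcoeffM scaler_sumr.
  by apply: eq_bigr => k _; rewrite scalerAr.
rewrite /eseries_mul; under [RHS]eq_bigr do rewrite mulr_suml.
rewrite [RHS]exchange_big; apply: eq_bigr => S _ /=.
rewrite -scalerAl (DlinZ Dlin) mulE scaler_sumr.
by apply: eq_bigr => k _; rewrite scalerAl.
Qed.

Fact id_sub_sumE x m : id_sub_sum A x m =
  \sum_i x i 0 *: id_sub_sum A (delta_mx i 0) m.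
Proof.
under eq_bigr do rewrite scalerBr.
rewrite sumrB /id_sub_sum; congr (_ - _).
  rewrite scaler_sumr; apply: eq_bigr => i _.
  by rewrite evec_delta !scalerA mulrC.
under [RHS]eq_bigr do rewrite scaler_sumr.
rewrite [RHS]exchange_big; apply: eq_bigr => j _ /=.
have evec_sum (I : finType) (X : I -> 'cV[K]_n) :
    evec (\sum_i X i) = \sum_i evec (X i).
  elim/big_rec2: _ => [|i y z _ <-]; last by rewrite evecD.
  by rewrite -(scale0r 0) evecZ scale0r.
rewrite {1}(matrix_sum_delta x) mulmx_sumr evec_sum scaler_sumr.
apply: eq_bigr => i _; rewrite big_ord1 -scalemxAr evecZ !scalerA.
by rewrite mulrC.
Qed.

Fact HS_extension_evec x : HS_extension (evec x) =1 id_sub_sum A x.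
Proof.
move=> m; rewrite (Dlin_sum HS_extension_linear) id_sub_sumE.
apply: eq_bigr => i _; rewrite (DlinZ HS_extension_linear).
by rewrite HS_extension_ebasis eprod1 coefF.
Qed.

Fact HS_extension_unique D :
  HS_derivation D -> (forall x, D (evec x) =1 id_sub_sum A x) ->
  forall u, D u =1 HS_extension u.
Proof.
case=> Dlin D1 DM DV u m.
rewrite (DlinE Dlin) (DlinE HS_extension_linear); apply: eq_bigr => S _.
congr (_ *: _); elim/set_min_ind: S m => [|i S ltiS IHS] m.
  by rewrite [LHS]D1 (HS_one HS_extension_HS).
have -> : ebasis K (i |: S) = evec (delta_mx i 0) * ebasis K S.
  rewrite evec_delta ebasisM /esign disjoints1 ifT.
    rewrite /inversions big_set1 big1 // => s /ltiS ltis.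
    by rewrite ltnNge ltnW.
  by apply/negP => /ltiS; rewrite ltnn.
rewrite DM (HS_mul HS_extension_HS); apply: eq_bigr => k _.
by rewrite DV HS_extension_evec IHS.
Qed.

Fact ext_homogM i j u v :
  ext_homog i u -> ext_homog j v -> ext_homog (i + j) (u * v).
Proof.
move=> hu hv U; apply: contraNeq => neU.
rewrite mul_exteriorE /wedge sum_ffunE big1 // => S _; rewrite sum_ffunE.
rewrite big1 // => T _; rewrite ffunE /ebasis_mul.
have [->|/hu cS] := eqVneq (u S) 0; first by rewrite mul0r scale0r.
have [->|/hv cT] := eqVneq (v T) 0; first by rewrite mulr0 scale0r.
case: ifP => [dST|_]; last by rewrite !ffunE scaler0.
rewrite !ffunE; case: eqVneq => [eU|_]; last by rewrite !scaler0.
by case/eqP: neU; rewrite eU cardsU disjoint_setI0 // cards0 subn0 cS cT.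
Qed.

Fact ext_homog_sum j (I : Type) (r : seq I) (P : pred I)
    (E : I -> exterior K n) :
  (forall i, ext_homog j (E i)) -> ext_homog j (\sum_(i <- r | P i) E i).
Proof.
move=> hE S; apply: contraNeq => neS; rewrite sum_ffunE big1 // => i _.
by apply/eqP; apply: contraNT neS => /hE ->.
Qed.

Fact ext_homogZ j a u : ext_homog j u -> ext_homog j (a *: u).
Proof.
move=> hu S; rewrite ffunE => auS; apply: hu.
by apply: contraNneq auS => ->; rewrite scaler0.
Qed.

Fact ext_homogD j u v :
  ext_homog j u -> ext_homog j v -> ext_homog j (u + v).
Proof.
move=> hu hv S; rewrite ffunE => uvS; have [uS|/hu//] := eqVneq (u S) 0.
by apply: hv; rewrite uS add0r in uvS.
Qed.

Fact evec_homog x : ext_homog 1 (evec x).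
Proof.
apply: ext_homog_sum => i; apply: ext_homogZ => S; rewrite ffunE.
by case: (eqVneq S) => [->|]; rewrite ?cards1 ?eqxx.
Qed.

Fact HS_extension_homog S m : ext_homog #|S| (HS_extension (ebasis K S) m).
Proof.
elim/set_min_ind: S m => [|i S ltiS IHS] m.
  rewrite [X in ext_homog _ X](HS_one HS_extension_HS) /eseries_one cards0 => T.
  case: (m == _); last by rewrite ffunE eqxx.
  by rewrite one_exteriorE ffunE; case: (eqVneq T) => [->|]; rewrite ?cards0 ?eqxx.
have iNS : i \notin S by apply/negP => /ltiS; rewrite ltnn.
rewrite HS_extension_ebasis eprod_min // mcoeffM cardsU1 iNS.
apply: ext_homog_sum => k; rewrite -HS_extension_ebasis.
apply: ext_homogM (IHS _); rewrite coefF.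
apply: ext_homogD; first exact/ext_homogZ/evec_homog.
rewrite -scaleN1r; apply: ext_homogZ; apply: ext_homog_sum => j.
exact/ext_homogZ/evec_homog.
Qed.

Fact ext_topE u : ext_homog n u -> u = u setT *: ebasis K setT.
Proof.
move=> hu; rewrite {1}(exteriorE u) (bigD1 setT) //= big1 ?addr0 // => S neS.
have [->|/hu cS] := eqVneq (u S) 0; first by rewrite scale0r.
by case/eqP: neS; apply/eqP; rewrite eqEcard subsetT cardsT card_ord cS /=.
Qed.

Definition multitrace (m : 'X_{1..n}) : K :=
  signed_coef HS_extension m (ebasis K setT) setT.

Fact multitraceP m u : ext_homog n u ->
  multitrace m *: u = signed_coef HS_extension m u.
Proof.
move=> /ext_topE ->; rewrite /signed_coef (DlinZ HS_extension_linear).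
have := @HS_extension_homog setT m; rewrite cardsT card_ord => /ext_topE eT.
rewrite /multitrace /signed_coef [in RHS]eT ffunE !scalerA.
congr (_ *: _); exact: mulrAC.
Qed.
End Existence.

Fact multitrace_exists (K : fieldType) (n : nat) (A : 'I_n -> 'M[K]_n) :
  exists (D : exterior K n -> eseries K n) (tau : 'X_{1..n} -> K),
    [/\ HS_derivation D, forall v, D (evec v) =1 id_sub_sum A v
      & forall m xi, ext_homog n xi -> xi != 0 ->
          tau m *: xi = signed_coef D m xi].
Proof.
exists (HS_extension A), (multitrace A).
split; [exact: HS_extension_HS|exact: HS_extension_evec|].
by move=> m xi hxi _; apply: multitraceP.
Qed.

Fact multitrace_unique (K : fieldType) (n : nat) (A : 'I_n -> 'M[K]_n)
    (D : exterior K n -> eseries K n) (tau : 'X_{1..n} -> K) :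
  HS_derivation D -> (forall v, D (evec v) =1 id_sub_sum A v) ->
  (forall m xi, ext_homog n xi -> xi != 0 ->
     tau m *: xi = signed_coef D m xi) ->
  (forall u, D u =1 HS_extension A u) /\ tau =1 multitrace A.
Proof.
move=> HSD DV tauP; have Deq := HS_extension_unique HSD DV.
split=> // m; pose e : exterior K n := ebasis K setT.
have eT : e setT = 1 by rewrite ffunE eqxx.
have ne0 : e != 0.
  by apply/eqP => e0; have /eqP := eT; rewrite e0 ffunE eq_sym oner_eq0.
have he : ext_homog n e.
  move=> S; rewrite ffunE; case: (eqVneq S) => [->|_]; last by rewrite eqxx.
  by rewrite cardsT card_ord.
have := tauP m e he ne0; rewrite /signed_coef Deq -/(signed_coef _ m e).
rewrite -(multitraceP _ _ he) => /ffunP/(_ setT); rewrite !ffunE eqxx.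
by rewrite /GRing.scale /= !mulr1.
Qed.

(* Main.v *)
(* Put B = A_1 z_1 + ... + A_n z_n, a matrix over K[z_1, ..., z_n].  On the   *)
(* top exterior power D(z) acts as det(1 - B), so that tau_m is the           *)
(* coefficient of z^m in (-1)^|m| det(1 - B).  As char_poly B is homogeneous  *)
(* of degree n in X and z together, the part of degree k in z of det(1 - B)   *)
(* is the coefficient of X^(n - k) in char_poly B.  The identity is then the  *)
(* coefficient of z_1 ... z_n in the Cayley-Hamilton relation for B, where    *)
(* B^(n - k) contributes the sum of the products A_(t_1) ... A_(t_(n-k)) over *)
(* the tuples t without repetition: these are the tails of permutations.      *)

Require Import Defs.
From mathcomp Require Import all_boot all_order all_fingroup all_algebra.
From mathcomp Require Import mpoly.

Set Implicit Arguments.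
Unset Strict Implicit.
Unset Printing Implicit Defensive.

Import GRing.Theory.
Local Open Scope ring_scope.

(** The identity is the Cayley-Hamilton relation of the single matrix B = [pencil A], polarized:
    only the coefficient of the multilinear monomial z_1 ... z_n is kept.

    Traces are translated first. D(z) is multiplicative, so it sends e_1 /\ ... /\ e_n to the wedge
    of the columns of 1 - B, which is det(1 - B) times e_1 /\ ... /\ e_n ([HS_extension_top],
    [trace_coef_det]); homogeneity turns coefficients of det(1 - B) into coefficients of the
    characteristic polynomial ([char_poly_pencil_coef]).

    Permutations come next. A summand depends on sigma only through its last n - k values, so the
    normalized sum over S_n is a sum over words of length n - k without repetition
    ([sum_perm_div_fact_tail]). These are the words whose monomial divides z_1 ... z_n
    ([mnm_of_seq_lep]), hence the ones that B^(n - k) contributes, and the quotient monomial is the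
    index of the trace. Both sides meet in [polarized_Cayley_Hamilton]. *)

Lemma index_enumE (T : finType) : index_enum T = enum T.
Proof. by rewrite enumT; case: index_enum_key. Qed.

(** * Anticommuting elements and determinants *)

Lemma lift_perm0P n (s : 'S_n.+1) :
  exists t : 'S_n, s = lift_perm ord0 (s ord0) t.
Proof.
pose g k := odflt k (unlift (s ord0) (s (lift ord0 k))).
have gE k : lift (s ord0) (g k) = s (lift ord0 k).
  rewrite /g; have:= neq_lift ord0 k.
  by rewrite -(can_eq (permK s)) => /unlift_some[] ? ? ->.
have g_inj : injective g.
  by move=> i j /(congr1 (lift (s ord0))); rewrite !gE => /perm_inj/lift_inj.
exists (perm g_inj); apply/permP => i; case: (unliftP ord0 i) => [j|] ->.
  by rewrite lift_perm_lift permE gE.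
by rewrite lift_perm_id.
Qed.

Section Anticommuting.
Variable R : nzRingType.

Lemma mul_prod_anticomm0 (I : eqType) (f : I -> R) (x : I) (r : seq I) :
  (forall i, f i * f i = 0) -> (forall i j, f i * f j = - (f j * f i)) ->
  x \in r -> f x * \prod_(y <- r) f y = 0.
Proof.
move=> ff0 ffN; elim: r => //= y r IHr; rewrite inE big_cons mulrA.
have [<- _|_ /= xr] := eqVneq x y; first by rewrite ff0 mul0r.
by rewrite ffN mulNr -mulrA IHr // mulr0 oppr0.
Qed.

Lemma prod_anticomm_nuniq (I : eqType) (f : I -> R) (r : seq I) :
  (forall i, f i * f i = 0) -> (forall i j, f i * f j = - (f j * f i)) ->
  ~~ uniq r -> \prod_(x <- r) f x = 0.
Proof.
move=> ff0 ffN; elim: r => //= x r IHr; rewrite big_cons negb_and negbK.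
by case/orP => [/mul_prod_anticomm0-> // | /IHr ->]; rewrite ?mulr0.
Qed.

(** Moving [f k] from the front to its own place crosses the k factors of smaller index. *)
Lemma mul_prod_anticomm_lift n (f : 'I_n.+1 -> R) k :
  (forall i, f i * f i = 0) -> (forall i j, f i * f j = - (f j * f i)) ->
  f k * \prod_i f (lift k i) = (-1) ^+ k * \prod_i f i.
Proof.
move=> ff0 ffN.
elim: n => [|n IHn] in f k ff0 ffN *.
  by rewrite ord1 big_ord0 big_ord_recl big_ord0 mul1r.
case: (unliftP ord0 k) => [j|] -> /=; last first.
  by rewrite [in RHS]big_ord_recl mul1r.
rewrite big_ord_recl [in RHS]big_ord_recl !mulrA.
have -> : lift (lift ord0 j) ord0 = ord0 by apply: val_inj.
rewrite ffN mulNr -[(-1) ^+ _ * _]commr_sign -!mulrA.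
under eq_bigr => i _.
  have -> : lift (lift ord0 j) (lift ord0 i) = lift ord0 (lift j i).
    by apply: val_inj; rewrite /= /bump /= !add1n ltnS addnS.
  over.
by rewrite (IHn (f \o lift ord0)) //= exprS mulN1r mulNr mulrN.
Qed.

(** Induct by splitting off the first factor: carrying [f (s ord0)] to its place costs (-1)^(s 0),
    which is also the ratio between the signs of [s] and of the permutation [t] left after deleting
    0 and its value. *)
Lemma prod_anticomm_perm n (f : 'I_n -> R) (s : 'S_n) :
  (forall i, f i * f i = 0) -> (forall i j, f i * f j = - (f j * f i)) ->
  \prod_i f (s i) = (-1) ^+ s * \prod_i f i.
Proof.
move=> ff0 ffN; elim: n => [|n IHn] in f s ff0 ffN *.
  by rewrite !big_ord0 permS0 odd_perm1 mulr1.
have [t ->] := lift_perm0P s; move: (s ord0) => k {s}.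
rewrite big_ord_recl lift_perm_id odd_lift_perm /= signr_addb signr_odd.
under eq_bigr => i _ do rewrite lift_perm_lift.
rewrite (IHn (f \o lift k)) //= mulrA commr_sign -[LHS]mulrA.
rewrite mul_prod_anticomm_lift // !mulrA; congr (_ * _); exact: commr_sign.
Qed.

(** This is the action of a matrix on a top form. Expand over all maps g: a non-injective g repeats
    a factor and gives 0, and the permutations give the Leibniz formula along columns, hence the
    transpose. *)
Lemma prod_anticomm_det (C : comNzRingType) (c : {rmorphism C -> R}) n
    (f : 'I_n -> R) (M : 'M[C]_n) :
  (forall i, f i * f i = 0) -> (forall i j, f i * f j = - (f j * f i)) ->
  (forall a i, f i * c a = c a * f i) ->
  \prod_i \sum_r c (M r i) * f r = c (\det M) * \prod_i f i.
Proof.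
move=> ff0 ffN fc.
have prod_fc (r : seq 'I_n) a :
    (\prod_(i <- r) f i) * c a = c a * \prod_(i <- r) f i.
  elim: r => [|i r IHr]; first by rewrite big_nil mulr1 mul1r.
  by rewrite big_cons -mulrA IHr !mulrA fc.
have prodE (g : 'I_n -> 'I_n) (r : seq 'I_n) :
    \prod_(i <- r) (c (M (g i) i) * f (g i)) =
    c (\prod_(i <- r) M (g i) i) * \prod_(i <- r) f (g i).
  elim: r => [|i r IHr]; first by rewrite !big_nil rmorph1 mulr1.
  by rewrite !big_cons IHr rmorphM !mulrA -(mulrA _ (f (g i))) fc !mulrA.
rewrite bigA_distr_bigA /= -det_tr /determinant rmorph_sum mulr_suml.
rewrite (bigID (fun g : {ffun _} => injectiveb g)) /= addrC big1 ?add0r; last first.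
  move=> g gNinj; rewrite prodE -(big_map g xpredT f).
  rewrite (prod_anticomm_nuniq ff0 ffN) ?mulr0 //.
  by apply: contra gNinj; rewrite /injectiveb /dinjectiveb -index_enumE.
rewrite (reindex (@pval _)) /=; last first.
  pose in_Sn := insubd (1%g : 'S_n).
  by exists in_Sn => /= g Ug; first apply: val_inj; apply: insubdK.
apply: eq_big => /= [s|s _]; first by rewrite (valP s).
rewrite prodE !pvalE (prod_anticomm_perm _ ff0 ffN).
rewrite rmorphM rmorph_sign mulrA commr_sign -!mulrA; congr (_ * (c _ * _)).
by apply: eq_bigr => i _; rewrite mxE.
Qed.

End Anticommuting.

(** * Traces as coefficients of det(1 - B) *)

Lemma mcoeffMC n (R : nzRingType) (p : {mpoly R[n]}) (c : R) m :
  (p * c%:MP)@_m = p@_m * c.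
Proof.
rewrite [in LHS](mpolyE p) [in RHS](mpolyE p) mulr_suml.
rewrite !(raddf_sum (mcoeff m)) mulr_suml; apply: eq_bigr => k _ /=.
rewrite -scalerAl -(commr_mpolyX k) !mcoeffZ mcoeffCM !mcoeffX.
by case: (_ == _); rewrite !(mulr1, mulr0, mul0r).
Qed.

Section UnitVectors.
Variables (K : fieldType) (n : nat).
Local Notation E := (exterior K n).
Local Notation e i := (ebasis K [set i] : E).

Lemma ebasis1_sqr0 (i : 'I_n) : e i * e i = 0.
Proof. by rewrite -evec_delta evec_sqr0. Qed.

Lemma ebasis1_anticomm (i j : 'I_n) : e i * e j = - (e j * e i).
Proof. by rewrite -!evec_delta evec_anticomm. Qed.

Lemma eprod_ebasis1 (S : {set 'I_n}) : eprod (fun i => e i) S = ebasis K S.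
Proof.
elim/set_min_ind: S => [|i S ltiS IHS]; first by rewrite eprod0.
rewrite eprod_min // IHS ebasisM /esign disjoints1 ifT.
  rewrite /inversions big_set1 big1 // => s /ltiS ltis.
  by rewrite ltnNge ltnW.
by apply/negP => /ltiS; rewrite ltnn.
Qed.

Lemma eprodT (R : nzRingType) (f : 'I_n -> R) : eprod f setT = \prod_i f i.
Proof. by rewrite /eprod enum_setT -enumT -index_enumE. Qed.

End UnitVectors.

Definition pencil (K : fieldType) (n : nat) (A : 'I_n -> 'M[K]_n) :
    'M[{mpoly K[n]}]_n :=
  \sum_j 'X_j *: map_mx (@mpolyC n K) (A j).

(** The image of e_i under D(z) is column i of 1 - B. *)
Lemma id_sub_sum_delta (K : fieldType) n (A : 'I_n -> 'M[K]_n) i m :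
  id_sub_sum A (delta_mx i 0) m =
  \sum_r ((1%:M - pencil A) r i)@_m *: ebasis K [set r].
Proof.
have evec_sum (I : finType) (F : I -> 'cV[K]_n) :
    evec (\sum_j F j) = \sum_j evec (F j).
  elim/big_rec2: _ => [|j y z _ <-]; last by rewrite evecD.
  by rewrite -(scale0r 0) evecZ scale0r.
rewrite /id_sub_sum -evecZ.
under eq_bigr do rewrite -evecZ.
rewrite -evec_sum -evecN -evecD /evec; apply: eq_bigr => r _.
rewrite !mxE mcoeffB eqxx andbT; congr ((_ - _) *: _).
  by case: (r == i); rewrite ?mcoeff1 ?mcoeff0 ?(mulr1, mulr0).
rewrite !summxE (raddf_sum (mcoeff m)); apply: eq_bigr => j _ /=.
rewrite !mxE mcoeffMC mcoeffX eq_sym; congr (_ * _).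
rewrite (bigD1 i) //= mxE !eqxx mulr1 big1 ?addr0 // => l neli.
by rewrite mxE (negPf neli) mulr0.
Qed.

Lemma HS_extension_top (K : fieldType) n (A : 'I_n -> 'M[K]_n) m :
  HS_extension A (ebasis K setT) m =
  (\det (1%:M - pencil A))@_m *: ebasis K setT.
Proof.
(* [f i] is D(z) e_i as a polynomial over the exterior algebra; unification recovers it from
   [HS_extension_ebasis]. *)
have [f fE] : exists f : 'I_n -> {mpoly (exterior K n)[n]},
    forall S k, HS_extension A (ebasis K S) k = (eprod f S)@_k.
  by eexists => S k; apply: HS_extension_ebasis.
(* The entries of 1 - B are scalar polynomials; [in_alg] carries them to polynomials over the
   exterior algebra, where they commute with the constants e_r. *)
rewrite fE eprodT; have -> : \prod_i f i = \prod_i (\sum_r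
    map_mpoly (in_alg (exterior K n)) ((1%:M - pencil A) r i) *
    (ebasis K [set r])%:MP_[n]).
  apply: eq_bigr => i _; apply/mpolyP => k.
  rewrite -(eprod1 f) -fE -evec_delta HS_extension_evec id_sub_sum_delta.
  rewrite (raddf_sum (mcoeff k)); apply: eq_bigr => r _ /=.
  by rewrite mcoeffMC mcoeff_map_mpoly /= mulr_algl.
pose e (i : 'I_n) := (ebasis K [set i])%:MP_[n].
rewrite (prod_anticomm_det _ (f := e)).
- by rewrite -rmorph_prod -eprodT eprod_ebasis1 mcoeffMC mcoeff_map_mpoly /= mulr_algl.
- by move=> i; rewrite -mpolyCM ebasis1_sqr0.
- by move=> i j; rewrite -!mpolyCM ebasis1_anticomm mpolyCN.
move=> p i; apply/mpolyP => k.
by rewrite mcoeffCM mcoeffMC !mcoeff_map_mpoly /= mulr_algr mulr_algl.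
Qed.

(** By uniqueness, [D] and [tau] may be replaced by the explicit extension and its traces. *)
Lemma trace_coef_det (K : fieldType) n (A : 'I_n -> 'M[K]_n)
    (D : exterior K n -> eseries K n) (tau : 'X_{1..n} -> K) :
  HS_derivation D -> (forall v, D (evec v) =1 id_sub_sum A v) ->
  (forall m xi, ext_homog n xi -> xi != 0 ->
     tau m *: xi = signed_coef D m xi) ->
  forall m, tau m = (-1) ^+ mdeg m * (\det (1%:M - pencil A))@_m.
Proof.
move=> DHS DV tauP m; have [_ ->] := multitrace_unique DHS DV tauP.
rewrite /multitrace /signed_coef HS_extension_top !ffunE eqxx.
by congr (_ * _); exact: mulr1.
Qed.

(** * Permutations grouped by their last n - k values *)

Section TailCount.
Variables (n k : nat).
Hypothesis le_kn : (k <= n)%N.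
Implicit Types (s : 'S_n) (t : (n - k).-tuple 'I_n).

(** Same condition as in the second branch of [sum_perm_div_fact], so that the two match by
    conversion. *)
Definition head_sorted s :=
  [forall i : 'I_n, forall j : 'I_n, (i < j < k)%N ==> (s i < s j)%N].

Lemma nth_codom_perm s x0 (i : 'I_n) : nth x0 (codom s) i = s i.
Proof.
by rewrite (nth_map i) ?size_enum_ord // nth_ord_enum.
Qed.

Lemma size_codom_perm s : size (codom s) = n.
Proof. by rewrite size_codom card_ord. Qed.

Fact size_tail s : size (drop k (codom s)) == (n - k)%N.
Proof. by rewrite size_drop size_codom_perm. Qed.

Definition tail s : (n - k).-tuple 'I_n := Tuple (size_tail s).

Lemma uniq_codom_perm s : uniq (codom s).
Proof. by apply/injectiveP; apply: perm_inj. Qed.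

Lemma mem_take_codom s : take k (codom s) =i [predC drop k (codom s)].
Proof.
move=> x; have := uniq_codom_perm s; have := codom_f s (s^-1%g x).
rewrite permKV -{1 2}(cat_take_drop k (codom s)) mem_cat cat_uniq inE /=.
case/orP=> [xt|xd] /and3P[_ /hasPn dt _].
  by rewrite xt; apply/esym/negP => /dt; rewrite /= xt.
by rewrite xd; apply/negP => xt; move: (dt _ xd); rewrite /= xt.
Qed.

Let lt_ord := relpre (val : 'I_n -> nat) ltn.
Let lt_ord_tr : transitive lt_ord.
Proof. by move=> i j l; apply: ltn_trans. Qed.

Lemma head_sortedE s : head_sorted s = sorted lt_ord (take k (codom s)).
Proof.
have nthT x0 (i : 'I_n) : (i < k)%N -> nth x0 (take k (codom s)) i = s i.
  by move=> lt_ik; rewrite nth_take // nth_codom_perm.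
have szT : size (take k (codom s)) = k by rewrite size_takel // size_codom_perm.
rewrite sorted_pairwise //; apply/idP/idP => [/'forall_forallP hs|].
  have [n0|n_gt0] := posnP n.
    have k0 : k = 0%N by apply/eqP; rewrite -leqn0 -n0.
    by rewrite k0 take0.
  pose x0 := Ordinal n_gt0.
  apply/(pairwiseP x0) => i j; rewrite !inE szT => ik jk ij.
  have [lti ltj] : (i < n)%N /\ (j < n)%N by split; apply: leq_trans le_kn.
  have := hs (Ordinal lti) (Ordinal ltj); rewrite /= ij jk /= => lt_s.
  by rewrite /lt_ord /= (nthT _ (Ordinal lti)) // (nthT _ (Ordinal ltj)).
move=> hs; apply/'forall_forallP => i j; apply/implyP => /andP[ij jk].
have ik := ltn_trans ij jk.
have /(_ i j) := pairwiseP i hs; rewrite !inE szT => /(_ ik jk ij).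
by rewrite /lt_ord /= !nthT.
Qed.

Lemma enum_ord_sorted (P : pred 'I_n) : sorted lt_ord (enum P).
Proof.
rewrite /enum_mem sorted_filter // -enumT -sorted_map val_enum_ord.
exact: iota_ltn_sorted.
Qed.

(** Put the complement of the word, in increasing order, in front of it. *)
Lemma completion_exists t : uniq t ->
  exists s : 'S_n, codom s = enum [predC t] ++ t.
Proof.
move=> ut; set L := _ ++ _.
have uL : uniq L.
  rewrite cat_uniq enum_uniq ut andbT; apply/hasPn => x xt /=.
  by rewrite mem_enum inE /= xt.
have szL : size L = n.
  rewrite -[RHS]card_ord -(card_uniqP uL); apply: eq_card => x.
  by rewrite mem_cat mem_enum !inE /= orNb.
pose g (i : 'I_n) := nth i L i.
have g_inj : injective g.
  move=> i j; rewrite /g (set_nth_default i) ?szL // => /eqP.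
  by rewrite nth_uniq ?szL // => /eqP/val_inj.
exists (perm g_inj); case: (posnP n) => [n0|n_gt0].
  by rewrite [LHS]size0nil ?[RHS]size0nil ?szL ?size_codom_perm.
pose x0 := Ordinal n_gt0.
apply: (eq_from_nth (x0 := x0)); rewrite size_codom_perm ?szL // => i lt_in.
rewrite -[i]/(val (Ordinal lt_in)) nth_codom_perm permE.
by apply: set_nth_default; rewrite szL.
Qed.

Lemma codom_perm_inj : injective (fun s : 'S_n => codom s).
Proof.
by move=> s s' eqs; apply/permP => i; rewrite -!(nth_codom_perm _ i) eqs.
Qed.

Lemma size_enum_compl t : uniq t -> size (enum [predC t]) = k.
Proof.
move=> ut; have := cardC (mem t); rewrite card_ord (card_uniqP ut) size_tuple.
rewrite -cardE => eqn; apply/eqP.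
by rewrite -(eqn_add2l (n - k)) [X in X == _]eqn subnK.
Qed.

(** The tail determines the set of head values, and a set has only one increasing enumeration. *)
Lemma card_head_sorted_tail t : uniq t ->
  #|[pred s | head_sorted s && (tail s == t)]| = 1%N.
Proof.
move=> ut; have [s0 s0E] := completion_exists ut.
rewrite -(card1 s0); apply: eq_card => s; rewrite !inE head_sortedE.
apply/andP/eqP => [[hs /eqP/(congr1 val)/= ts]|->]; last first.
  rewrite -val_eqE /= s0E take_size_cat ?size_enum_compl //.
  by rewrite drop_size_cat ?size_enum_compl ?enum_ord_sorted.
apply: codom_perm_inj; rewrite /= s0E -(cat_take_drop k (codom s)) ts.
congr (_ ++ _); apply: (irr_sorted_eq lt_ord_tr) => // [i||x].
- by rewrite /lt_ord /= ltnn.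
- exact: enum_ord_sorted.
by rewrite mem_take_codom ts mem_enum.
Qed.

Lemma eq_tail s s' :
  (tail s == tail s') = [forall i : 'I_n, (k <= i)%N ==> (s i == s' i)].
Proof.
apply/eqP/'forall_implyP => [/(congr1 val)/= eqt i le_ki|eqs].
  by rewrite -!(nth_codom_perm _ i) -(subnKC le_ki) -!nth_drop eqt.
apply: val_inj => /=; rewrite !codomE -[LHS]map_drop -[RHS]map_drop.
apply/eq_in_map => i; case/(nthP i) => j; rewrite size_drop size_enum_ord => lt_j.
rewrite nth_drop => <-; apply/eqP/eqs.
by rewrite nth_enum_ord ?leq_addr // -ltn_subRL.
Qed.

Lemma card_tail t : uniq t -> #|[pred s | tail s == t]| = k`!.
Proof.
move=> ut; have [s0 s0E] := completion_exists ut.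
have <- : tail s0 = t.
  apply: val_inj; rewrite /= s0E -{1}(size_enum_compl ut).
  by rewrite drop_size_cat.
have cardk : #|[set i : 'I_n | (i < k)%N]| = k.
  rewrite -sum1dep_card (big_ord_narrow le_kn) /=.
  by rewrite sum1_card card_ord.
(* The permutations with the tail of s0 form the coset of s0 modulo those      *)
(* supported on {i | i < k}.                                                  *)
rewrite -[in RHS]cardk -card_perm -[RHS](card_imset _ (mulIg s0)).
apply: eq_card => s; rewrite inE eq_tail.
apply/'forall_implyP/imsetP => [eqs|[h hP -> i le_ki]].
  exists (s * s0^-1)%g; last by rewrite mulgKV.
  apply/subsetP => i; rewrite !inE permM; apply: contraR; rewrite -leqNgt.
  by move/eqs/eqP->; rewrite permK.
by rewrite permM (out_perm hP) // inE -leqNgt.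
Qed.

(** A word without repetition is the tail of k! permutations, exactly one of which has an increasing
    head; so both readings of 1/k! give the same sum. *)
Lemma sum_perm_div_fact_tail (K : fieldType) (G : seq 'I_n -> 'M[K]_n) :
  sum_perm_div_fact k (fun s => G (tail s)) =
  \sum_(t : (n - k).-tuple 'I_n | uniq t) G t.
Proof.
have sumE (P : pred 'S_n) : \sum_(s | P s) G (tail s) =
    \sum_(t : (n - k).-tuple 'I_n | uniq t)
       G t *+ #|[pred s | P s && (tail s == t)]|.
  rewrite (partition_big tail (fun t : (n - k).-tuple 'I_n => uniq t))
    => [|s _]; last first.
    by rewrite drop_uniq // uniq_codom_perm.
  apply: eq_bigr => t _; rewrite -sumr_const.
  by apply: eq_big => [s|s /andP[_ /eqP->]].
rewrite /sum_perm_div_fact; case: ifP => [k_neq0|_].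
  rewrite sumE scaler_sumr; apply: eq_bigr => t ut.
  by rewrite card_tail // -scaler_nat scalerA mulVf // scale1r.
rewrite [LHS](sumE head_sorted); apply: eq_bigr => t ut.
by rewrite card_head_sorted_tail.
Qed.

Lemma filter_geq_enum_ord :
  [seq i : 'I_n <- enum 'I_n | (k <= i)%N] = drop k (enum 'I_n).
Proof.
apply: (inj_map val_inj); rewrite map_drop val_enum_ord.
rewrite -(filter_map val (leq k)) val_enum_ord -(subnKC le_kn) iotaD filter_cat.
rewrite drop_size_cat ?size_iota // add0n.
rewrite (eq_in_filter (a2 := pred0)) => [|i]; last first.
  by rewrite mem_iota add0n /= ltnNge => /negbTE.
rewrite filter_pred0 /=; apply/all_filterP/allP => i.
by rewrite mem_iota => /andP[].
Qed.

Lemma prod_tail (R : pzSemiRingType) (F : 'I_n -> R) s :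
  \prod_(j < n | (k <= j)%N) F (s j) = \prod_(i <- tail s) F i.
Proof.
rewrite index_enumE -[LHS]big_filter filter_geq_enum_ord.
by rewrite /= codomE -map_drop big_map.
Qed.

(** Makes the index of the trace a function of the tail alone. *)
Lemma sum_mnm_tail s :
  (\sum_(j < n | (j < k)%N) U_(s j) =
   \sum_(i < n) U_(i) - \sum_(i <- tail s) U_(i))%MM.
Proof.
rewrite [X in (X - _)%MM](reindex_perm s).
rewrite [X in (X - _)%MM](bigID (fun j : 'I_n => (j < k)%N)) /=.
rewrite -[X in (_ - X)%MM](_ : \sum_(j < n | ~~ (j < k)%N) U_(s j) = _)%MM.
  by rewrite addmK.
rewrite index_enumE -[LHS]big_filter.
under eq_filter => j do rewrite -leqNgt.
by rewrite filter_geq_enum_ord /= codomE -map_drop big_map.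
Qed.

End TailCount.

Lemma mcoeffMX_if n (R : nzRingType) (p : {mpoly R[n]}) k m :
  (p * 'X_[k])@_m = if (k <= m)%MM then p@_(m - k) else 0.
Proof.
case: ifP => [le_km|/negP nle_km]; first by rewrite -{1}(submK le_km) addmC mcoeffMX.
rewrite mcoeffM big1 // => -[i j] /= /eqP def_m; rewrite mcoeffX.
case: eqP => [def_j|_]; last by rewrite mulr0.
by case: nle_km; rewrite def_m -def_j lem_addl.
Qed.

(** * Homogeneity of the characteristic polynomial of B *)

Section Homogeneity.
Variables (n : nat) (R : comNzRingType).
Implicit Types p q : {poly {mpoly R[n]}}.

(* Total degree d, the polynomial variable counting for one. *)
Definition bihomog d p :=
  forall i m, (p`_i)@_m != 0 -> (i + mdeg m)%N = d.

Lemma bihomogM d1 d2 p q :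
  bihomog d1 p -> bihomog d2 q -> bihomog (d1 + d2) (p * q).
Proof.
move=> hp hq i m; apply: contraNeq => ne_d.
rewrite coefM (raddf_sum (mcoeff m)) big1 // => j _ /=.
rewrite mcoeffM big1 // => -[k l] /= /eqP def_m.
have [->|/hp def_d1] := eqVneq (p`_j)@_k 0; first by rewrite mul0r.
have [->|/hq def_d2] := eqVneq (q`_(i - j))@_l 0; first by rewrite mulr0.
case/eqP: ne_d; rewrite -def_d1 -def_d2 addnACA subnKC; last by rewrite -ltnS.
by rewrite -mdegD -def_m.
Qed.

Lemma bihomog_prod (I : Type) (r : seq I) (F : I -> {poly {mpoly R[n]}}) :
  (forall i, bihomog 1 (F i)) -> bihomog (size r) (\prod_(i <- r) F i).
Proof.
move=> hF; elim: r => [|i r IHr]; last by rewrite big_cons; apply: (@bihomogM 1).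
move=> i m; rewrite big_nil coef1; case: i => [|i] /=; last by rewrite mcoeff0 eqxx.
by rewrite mcoeff1; case: (eqVneq m) => [->|]; rewrite ?mdeg0 ?eqxx.
Qed.

Lemma bihomog_det N (M : 'M[{poly {mpoly R[n]}}]_N) :
  (forall i j, bihomog 1 (M i j)) -> bihomog N (\det M).
Proof.
move=> hM i m; apply: contraNeq => ne_N.
rewrite coef_sum (raddf_sum (mcoeff m)) big1 // => s _ /=.
have hprod : bihomog N (\prod_j M j (s j)).
  by rewrite -{1}(size_enum_ord N) index_enumE; apply: bihomog_prod.
rewrite mulr_sign; apply/eqP; apply: contraNT ne_N.
case: (odd_perm s); last by move/hprod->.
by rewrite coefN mcoeffN oppr_eq0 => /hprod->.
Qed.
End Homogeneity.

Section Pencil.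
Variables (K : fieldType) (n : nat) (A : 'I_n -> 'M[K]_n).

Lemma mcoeff_pencil i j m :
  (pencil A i j)@_m = \sum_l (m == U_(l)%MM)%:R * A l i j.
Proof.
rewrite summxE (raddf_sum (mcoeff m)); apply: eq_bigr => l _ /=.
by rewrite !mxE mcoeffMC mcoeffX eq_sym.
Qed.

Lemma char_poly_pencil_homog : bihomog n (char_poly (pencil A)).
Proof.
apply: bihomog_det => a b i m; rewrite !mxE coefB coefMn coefX coefC mcoeffB mcoeffMn.
case: i => [|[|i]] /=; rewrite ?mcoeff0 ?mcoeff1 ?mul0rn ?sub0r ?subr0 ?oppr0 ?eqxx //.
- rewrite oppr_eq0 mcoeff_pencil => nz.
  have [l /eqP-> | U] := pickP (fun l => m == U_(l)%MM); first by rewrite mdeg1.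
  by case/eqP: nz; rewrite big1 // => l _; rewrite U mul0r.
by case: (eqVneq m) => [->|]; rewrite ?mdeg0 // mul0rn eqxx.
Qed.

(** det(1 - B) is the characteristic polynomial at X = 1, which sums its coefficients; by
    homogeneity only that of X^(n - |m|) can contain z^m. *)
Lemma char_poly_pencil_coef m : (mdeg m <= n)%N ->
  ((char_poly (pencil A))`_(n - mdeg m))@_m = (\det (1%:M - pencil A))@_m.
Proof.
move=> le_mn.
have -> : \det (1%:M - pencil A) = (char_poly (pencil A)).[1].
  rewrite -horner_evalE -det_map_mx; congr (\det _); apply/matrixP => i j.
  by rewrite !mxE /= horner_evalE hornerD hornerN hornerC hornerMn hornerX.
rewrite horner_coef size_char_poly (raddf_sum (mcoeff m)) /=.
have lt_i : (n - mdeg m < n.+1)%N by rewrite ltnS leq_subr.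
rewrite (bigD1 (Ordinal lt_i)) //= expr1n mulr1 big1 ?addr0 // => i ne_i.
rewrite expr1n mulr1; apply: contraNeq ne_i => /char_poly_pencil_homog def_n.
by apply/eqP/val_inj; have := congr1 (subn^~ (mdeg m)) def_n; rewrite /= addnK.
Qed.
End Pencil.

(** * The multilinear coefficient of the Cayley-Hamilton relation *)

Definition mnm_of_seq n (t : seq 'I_n) : 'X_{1..n} := (\sum_(i <- t) U_(i))%MM.

Lemma mnm_of_seqE n (t : seq 'I_n) i : mnm_of_seq t i = count_mem i t.
Proof.
rewrite mnm_sumE -sum1_count [RHS]big_mkcond; apply: eq_bigr => j _ /=.
by rewrite mnm1E; case: (j == i).
Qed.

(** The divisors of z_1 ... z_n are the squarefree monomials. *)
Lemma mnm_of_seq_lep n (t : seq 'I_n) :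
  (mnm_of_seq t <= \sum_(i < n) U_(i))%MM = uniq t.
Proof.
have oneE i : (\sum_(i < n) U_(i))%MM i = 1%N.
  by rewrite index_enumE [LHS]mnm_of_seqE count_uniq_mem ?enum_uniq ?mem_enum.
apply/mnm_lepP/idP => [le1|ut i]; last first.
  by rewrite oneE mnm_of_seqE count_uniq_mem // leq_b1.
apply: count_mem_uniq => i; have := le1 i.
rewrite oneE mnm_of_seqE -has_pred1 has_count.
by case: (count _ _) => [|[]].
Qed.

(** The A_i need not commute, so the power expands into one term per word; only the monomials in z
    forget the order. *)
Lemma pencil_expr (K : fieldType) n (A : 'I_n.+1 -> 'M[K]_n.+1) j :
  pencil A ^+ j = \sum_(t : j.-tuple 'I_n.+1)
    'X_[mnm_of_seq t] *: map_mx (@mpolyC _ K) (\prod_(i <- t) A i).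
Proof.
rewrite -{1}(card_ord j) -prodr_const bigA_distr_bigA /=.
rewrite (reindex (fun t : j.-tuple 'I_n.+1 => [ffun i => tnth t i])) /=; last first.
  exists (fun g : {ffun 'I_j -> 'I_n.+1} => mktuple g) => [t|g] _.
    by apply: eq_from_tnth => i; rewrite tnth_mktuple ffunE.
  by apply/ffunP => i; rewrite ffunE tnth_mktuple.
apply: eq_bigr => t _; under eq_bigr do rewrite ffunE.
rewrite -(big_tuple _ _ t xpredT (fun i => 'X_i *: map_mx (@mpolyC _ K) (A i))).
elim: (tval t) => [|i r IHr].
  by rewrite /mnm_of_seq !big_nil mpolyX0 scale1r map_mx1.
rewrite /mnm_of_seq !big_cons mpolyXD IHr -scalerAl -scalerAr scalerA.
by rewrite [map_mx _ (_ * _)]map_mxM.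
Qed.

Lemma mcoeff_pencil_expr (K : fieldType) n (A : 'I_n.+1 -> 'M[K]_n.+1) j
    (c : {mpoly K[n.+1]}) m a b :
  ((c *: pencil A ^+ j) a b)@_m =
  \sum_(t : j.-tuple 'I_n.+1 | (mnm_of_seq t <= m)%MM)
     c@_(m - mnm_of_seq t) * (\prod_(i <- t) A i) a b.
Proof.
rewrite pencil_expr scaler_sumr summxE (raddf_sum (mcoeff m)) [RHS]big_mkcond.
apply: eq_bigr => t _ /=; rewrite !mxE mulrA mcoeffMC mcoeffMX_if.
by case: ifP; rewrite ?mul0r.
Qed.

Lemma eq_sum_perm_div_fact (K : fieldType) n k (F G : 'S_n -> 'M[K]_n) :
  F =1 G -> sum_perm_div_fact k F = sum_perm_div_fact k G.
Proof.
move=> eqFG; rewrite /sum_perm_div_fact.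
by case: ifP => _; [congr (_ *: _)|]; apply: eq_bigr => s _; apply: eqFG.
Qed.

Lemma mdeg_compl n k (t : (n - k).-tuple 'I_n) : (k <= n)%N -> uniq t ->
  mdeg (\sum_(i < n) U_(i) - mnm_of_seq t) = k.
Proof.
move=> le_kn ut; apply/eqP; rewrite -(eqn_add2r (mdeg (mnm_of_seq t))) -mdegD.
rewrite submK ?mnm_of_seq_lep // !mdeg_sum !(eq_bigr _ (fun i _ => mdeg1 i)).
by rewrite !sum1_size size_tuple index_enumE size_enum_ord subnKC.
Qed.

Lemma polarized_Cayley_Hamilton (K : fieldType) n (A : 'I_n.+1 -> 'M[K]_n.+1) :
  \sum_(k < n.+2) \sum_(t : (n.+1 - k).-tuple 'I_n.+1 | uniq t)
    (\det (1%:M - pencil A))@_(\sum_i U_(i) - mnm_of_seq t) *: \prod_(i <- t) A i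
  = 0.
Proof.
pose CP := char_poly (pencil A); pose m1 := (\sum_(i < n.+1) U_(i))%MM.
have CH : \sum_(i < n.+2) CP`_i *: pencil A ^+ i = 0.
  rewrite -[RHS](Cayley_Hamilton (pencil A)) -/CP -{2}[CP]coefK poly_def.
  rewrite size_char_poly rmorph_sum; apply: eq_bigr => i _ /=.
  by rewrite linearZ rmorphXn /= horner_mx_X.
apply/matrixP => a b; rewrite mxE.
transitivity (((\sum_(i < n.+2) CP`_i *: pencil A ^+ i) a b)@_m1); last first.
  by rewrite CH mxE mcoeff0.
(* Reversing the sum pairs the index k with the power B^(n + 1 - k), whose words have the length of
   a tail. *)
rewrite !summxE (raddf_sum (mcoeff m1)) [RHS](reindex_inj rev_ord_inj) /=.
apply: eq_bigr => k _; rewrite mcoeff_pencil_expr summxE subSS.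
apply: eq_big => [t|t ut]; first by rewrite mnm_of_seq_lep.
have le_kn : (k <= n.+1)%N by rewrite -ltnS.
by rewrite mxE -char_poly_pencil_coef mdeg_compl.
Qed.

Theorem corollary4p9 (K : fieldType) (n : nat) (A : 'I_n -> 'M[K]_n)
    (Dbar : exterior K n -> eseries K n)
    (Dbar_HS : HS_derivation Dbar)
    (Dbar_V : forall v : 'cV[K]_n, Dbar (evec v) =1 id_sub_sum A v)
    (tau : 'X_{1..n} -> K)
    (tau_def : forall (m : 'X_{1..n}) (xi : exterior K n),
       ext_homog n xi -> xi != 0 -> tau m *: xi = signed_coef Dbar m xi) :
  \sum_(k < n.+1) (-1) ^+ k *:
    sum_perm_div_fact k (fun s : 'S_n =>
      tau (\sum_(j < n | (j < k)%N) U_(s j))%MM *: \prod_(j < n | (k <= j)%N) A (s j))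
  = 0.
Proof.
have tauE := trace_coef_det Dbar_HS Dbar_V tau_def.
(* In size 0 there are no entries to compare; the Cayley-Hamilton identity above is stated in size
   [n.+1]. *)
case: n => [|n] in A Dbar Dbar_HS Dbar_V tau tau_def tauE *.
  by apply/matrixP => -[].
rewrite -[RHS](polarized_Cayley_Hamilton A); apply: eq_bigr => k _.
have le_kn : (k <= n.+1)%N by rewrite -ltnS.
pose G (t : seq 'I_n.+1) := tau (\sum_(i < n.+1) U_(i) - mnm_of_seq t)%MM *:
  \prod_(i <- t) A i.
rewrite (@eq_sum_perm_div_fact _ _ _ _ (fun s => G (tail k s))) => [|s]; last first.
  by rewrite /G -sum_mnm_tail // prod_tail.
rewrite sum_perm_div_fact_tail // scaler_sumr; apply: eq_bigr => t ut.
(* The index of the trace has degree k, so the sign (-1)^|m| in [tauE] cancels the (-1)^k of the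
   statement. *)
by rewrite /G scalerA tauE mdeg_compl // signrMK.
Qed.
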